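(* Let $k\in\mathbb{N}$. There exists an almost law $(w_n)_n$ for $\mathrm{SU}(k)$ and a constant $C>0$ such that $$L_k(w_n)\le\exp\left(-C\cdot\ell(w_n)^{\log_2(\varphi)}\right)\quad\text{for all } n,$$ where $\varphi$ is the golden ratio.
   Context: $\mathbb{F}_2$ is the free group on two generators, $\ell$ the word length with respect to the free generators and their inverses. For $w\in\mathbb{F}_2$, the word map $w\colon\mathrm{SU}(k)\times\mathrm{SU}(k)\to\mathrm{SU}(k)$ is given by evaluation. On $\mathrm{SU}(k)$ use the metric $d(u,v)=\|u-v\|$ with $\|\cdot\|$ the operator norm, and set $L_k(w):=\max\{d(1_k,w(u,v))\mid u,v\in\mathrm{SU}(k)\}$. An almost law for $\mathrm{SU}(k)$ is a sequence $(w_n)$ of non-trivial elements of $\mathbb{F}_2$ such that for every neighbourhood $U$ of the identity in $\mathrm{SU}(k)$ there is $N$ with $w_n(\mathrm{SU}(k)\times\mathrm{SU}(k))\subset U$ for all $n\ge N$. *)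

(* Defs.v *)
From mathcomp Require Import all_boot all_order all_algebra.
From mathcomp Require Import all_classical all_reals all_analysis.
From mathcomp Require Export complex.
Import GRing.Theory Num.Theory.
Set Implicit Arguments. Unset Strict Implicit. Unset Printing Implicit Defensive.
Local Open Scope ring_scope.

(* A letter is (g, e) : bool * bool; g = false means generator a, g = true
   means generator b; e = true means the inverse of that generator. *)
Definition letter := (bool * bool)%type.

Definition inv_letter (x : letter) : letter := (x.1, ~~ x.2).

Fixpoint reduced (s : seq letter) : bool :=
  match s with
  | x :: ((y :: _) as t) => (y != inv_letter x) && reduced t
  | _ => true
  end.

(* Elements of F_2, represented by their (unique) reduced normal form. *)
Definition F2 := {s : seq letter | reduced s}.

Definition nontrivial (w : F2) : bool := sval w != [::].

Definition wlen (w : F2) : nat := size (sval w).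

Section SU.
Variable R : realType.
Variable k : nat.

Definition adjmx (A : 'M[R[i]]_k) : 'M[R[i]]_k := (map_mx Num.conj A)^T.

Definition SU : set 'M[R[i]]_k :=
  [set U | adjmx U *m U = 1%:M /\ \det U = 1].

Definition vnorm (v : 'cV[R[i]]_k) : R :=
  Num.sqrt (\sum_i (complex.Re (v i 0) ^+ 2 + complex.Im (v i 0) ^+ 2)).

Definition opnorm (A : 'M[R[i]]_k) : R :=
  sup [set x : R | exists v : 'cV[R[i]]_k, vnorm v <= 1 /\ x = vnorm (A *m v)].

Definition dist (A B : 'M[R[i]]_k) : R := opnorm (A - B).

Definition eval_letter (u v : 'M[R[i]]_k) (x : letter) : 'M[R[i]]_k :=
  let g := if x.1 then v else u in if x.2 then invmx g else g.

Definition word_map (w : F2) (u v : 'M[R[i]]_k) : 'M[R[i]]_k :=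
  foldr (fun x M => eval_letter u v x *m M) 1%:M (sval w).

(* L_k(w) = max { d(1, w(u,v)) | u, v in SU(k) } (the max exists by
   compactness, so it equals the sup). *)
Definition Lk (w : F2) : R :=
  sup [set x : R | exists u v, SU u /\ SU v /\ x = dist 1%:M (word_map w u v)].

Definition almost_law (w : nat -> F2) : Prop :=
  (forall n, nontrivial (w n)) /\
  forall eps : R, 0 < eps -> exists N : nat, forall n, (N <= n)%N ->
    forall u v, SU u -> SU v -> dist 1%:M (word_map (w n) u v) < eps.

End SU.

Definition golden_ratio (R : realType) : R := (1 + Num.sqrt 5) / 2.

(* Main.v *)
Require Import Defs.
From mathcomp Require Import all_boot all_order all_algebra.
From mathcomp Require Import all_classical all_reals all_analysis.
From mathcomp Require Import ring lra zify.
Set Implicit Arguments. Unset Strict Implicit. Unset Printing Implicit Defensive.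
Import Order.TTheory GRing.Theory Num.Theory.
Local Open Scope ring_scope.

(** For unitary [a], [b] one has [|[a, b] - 1| <= 2 |a - 1| |b - 1|]. Hence, along
    [x_(n+2) = [x_(n+1), x_n^-1]] started from two words that are uniformly close
    to 1, [- ln (2 |x_n - 1|)] grows at least like the Fibonacci numbers, while
    cancellations keep the length of [x_n] of order [2^n].

    To get the first two words, some power [u^i] with [1 <= i <= M] is close to 1,
    with [M] depending on [k] only. A word [W(x, y)] built from commutators, whose
    distance to 1 is at most [32 min(|x - 1|, |y - 1|)^2], merges conjugates of
    [a, a^2, ..., a^M] into a single word close to 1 everywhere.

    Non-triviality is detected in the group generated by the rational quaternions
    [(3 + 4i) / 5] and [(3 + 4j) / 5]: their products have a 2-adically odd, hence
    non-zero, real part, and for quaternions with non-zero real part, [p]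
    commutes with a conjugate [q^-1 p q] only if it commutes with [q]. So
    non-commuting pairs [(p, q)] yield non-commuting pairs [([p, q^-1], p)]. *)

(** * Words and their evaluations *)

Definition winv (s : seq letter) : seq letter := rev (map inv_letter s).

(** The inverse sits on [t]: this is $[s, t^{-1}]$, that is, [s] times the conjugate by [t] of its
    inverse. *)
Definition wcomm (s t : seq letter) : seq letter := s ++ winv t ++ winv s ++ t.

Definition wconj (t s : seq letter) : seq letter := winv t ++ s ++ t.

Definition push_letter (x : letter) (s : seq letter) : seq letter :=
  if s is y :: t then if y == inv_letter x then t else x :: s else [:: x].

Definition freduce (s : seq letter) : seq letter := foldr push_letter [::] s.

Lemma inv_letterK : involutive inv_letter.
Proof. by case=> g e; rewrite /inv_letter /= negbK. Qed.

Lemma winvK : involutive winv.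
Proof.
by move=> s; rewrite /winv map_rev revK -map_comp map_id_in // => x _ /=;
  rewrite inv_letterK.
Qed.

Lemma size_winv s : size (winv s) = size s.
Proof. by rewrite size_rev size_map. Qed.

Lemma winv_cat s t : winv (s ++ t) = winv t ++ winv s.
Proof. by rewrite /winv map_cat rev_cat. Qed.

Lemma reduced_tail x s : reduced (x :: s) -> reduced s.
Proof. by case: s => // y s /= /andP[]. Qed.

Lemma reduced_push x s : reduced s -> reduced (push_letter x s).
Proof.
case: s => // y t rs; rewrite /push_letter.
case: ifPn => [_|yx]; first exact: reduced_tail rs.
by move: rs => /= ->; rewrite yx.
Qed.

Lemma reduced_freduce s : reduced (freduce s).
Proof. by elim: s => //= x s; apply: reduced_push. Qed.

Lemma size_freduce s : (size (freduce s) <= size s)%N.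
Proof.
elim: s => //= x s IH.
suff : (size (push_letter x (freduce s)) <= (size (freduce s)).+1)%N by lia.
by case: (freduce s) => //= y t; case: ifP => //= _; lia.
Qed.

(* The words [x_0 = t], [x_1 = s], [x_(n+2) = [x_(n+1), x_n^-1]], carried as
   [(x_n, x_(n+1), q_n, q_(n+1))] with [q_n = x_n^-1 x_(n+1)]. The identity
   [q_(n+2) = x_(n+1)^-1 q_n x_n] performs the cancellations that keep the
   growth factor of the lengths down to 2. *)
Fixpoint fib_state (s t : seq letter) (n : nat) :=
  if n is m.+1 then
    let: (x, y, p, q) := fib_state s t m in
    (y, y ++ q, q, winv y ++ p ++ x)
  else (t, s, winv t ++ s, winv t ++ winv s ++ t).

Definition fib_word s t n : seq letter := (fib_state s t n).1.1.1.

(** The new lengths are at most |y| + |q| and |y| + |p| + |x|, both within twice the bound on [y]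
    and [q]. The leading factor 2 makes room for the initial quotient [winv t ++ s]. *)
Lemma size_fib_word s t n :
  (size (fib_word s t n) <= 2 * maxn (size s) (size t) * 2 ^ n)%N.
Proof.
set m := maxn _ _.
have hs : (size s <= m)%N by exact: leq_maxl.
have ht : (size t <= m)%N by exact: leq_maxr.
suff : (let: (x, y, p, q) := fib_state s t n in
   [/\ size x <= 2 * m * 2 ^ n, size p <= 2 * m * 2 ^ n,
   size y <= 2 * m * 2 ^ n.+1 & size q <= 2 * m * 2 ^ n.+1])%N.
  by rewrite /fib_word; case: (fib_state s t n) => [[[x y] p] q] [].
elim: n => [|n] /=; first by rewrite !size_cat !size_winv; split; lia.
case: (fib_state s t n) => [[[x y] p] q] [hx hp hy hq].
by rewrite !size_cat size_winv; split => //; move: hx hp hy hq; rewrite !expnS; lia.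
Qed.

(** * Evaluation of words in a monoid *)

Section Evaluation.
Variables (T : Type) (mul : T -> T -> T) (one : T) (h : letter -> T).
Hypotheses (mulA : associative mul) (mul1 : left_id one mul).
Hypotheses (mulx1 : right_id one mul).
Hypothesis hV : forall x, mul (h (inv_letter x)) (h x) = one.

(** Kept abstract so as to serve both quaternions and matrices. *)
Definition weval (s : seq letter) : T := foldr (fun x M => mul (h x) M) one s.

Lemma weval_cat s t : weval (s ++ t) = mul (weval s) (weval t).
Proof. by elim: s => [|x s IH] /=; rewrite ?mul1 // IH mulA. Qed.

Lemma weval_winvl s : mul (weval (winv s)) (weval s) = one.
Proof.
elim: s => [|x s IH] /=; first by rewrite mul1.
rewrite /winv /= rev_cons -cats1 weval_cat /= mulx1.
by rewrite -mulA [mul (h _) (mul _ _)]mulA hV mul1.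
Qed.

Lemma weval_winvr s : mul (weval s) (weval (winv s)) = one.
Proof. by rewrite -{1}[s]winvK weval_winvl. Qed.

Lemma weval_Kl s t : mul (weval (winv s)) (mul (weval s) t) = t.
Proof. by rewrite mulA weval_winvl mul1. Qed.

Lemma weval_Kr s t : mul (weval s) (mul (weval (winv s)) t) = t.
Proof. by rewrite mulA weval_winvr mul1. Qed.

Lemma weval_freduce s : weval (freduce s) = weval s.
Proof.
elim: s => //= x s <-; case: (freduce s) => //= y t.
case: eqP => // ->.
by rewrite mulA; have := hV (inv_letter x); rewrite inv_letterK => ->; rewrite mul1.
Qed.

Lemma weval_fib_word s t n :
  weval (fib_word s t n.+2) =
  weval (wcomm (fib_word s t n.+1) (fib_word s t n)).
Proof.
rewrite /fib_word /=.
suff : let: (x, y, p, q) := fib_state s t n in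
   weval p = weval (winv x ++ y) /\ weval q = weval (winv x ++ winv y ++ x).
  case: (fib_state s t n) => [[[x y] p] q] [_ hq] /=.
  by rewrite /wcomm !weval_cat hq !weval_cat.
elim: n => [|n] //=; case: (fib_state s t n) => [[[x y] p] q] [hp hq].
(* Inverting $q = x^{-1} y^{-1} x$ gives $x^{-1} y x = p x$: this is the cancellation that justifies
   the recursion for the last component. *)
have hqV : weval (winv q) = weval (p ++ x).
  rewrite -[LHS]mulx1 -[RHS](weval_Kl q) !weval_cat hq hp !weval_cat -!mulA.
  by rewrite !(weval_Kl, weval_Kr) weval_winvl.
rewrite !weval_cat weval_Kl winv_cat !weval_cat hqV !weval_cat -!mulA.
by rewrite weval_winvl mulx1.
Qed.
End Evaluation.

(** * A group of rational quaternions *)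

Record quat := Quat {qr : rat; qi : rat; qj : rat; qk : rat}.

Definition qone : quat := Quat 1 0 0 0.

Definition qmul (p q : quat) : quat :=
  let: Quat a b c d := p in let: Quat a' b' c' d' := q in
  Quat (a * a' - b * b' - c * c' - d * d')
       (a * b' + b * a' + c * d' - d * c')
       (a * c' - b * d' + c * a' + d * b')
       (a * d' + b * c' - c * b' + d * a').

Definition qconj (p : quat) : quat := Quat (qr p) (- qi p) (- qj p) (- qk p).

Definition qcomm (p q : quat) : Prop := qmul p q = qmul q p.

Lemma qmulA : associative qmul.
Proof. by move=> [????] [????] [????] /=; congr Quat; ring. Qed.

Lemma qmul1 : left_id qone qmul.
Proof. by move=> [????] /=; congr Quat; ring. Qed.

Lemma qmulx1 : right_id qone qmul.
Proof. by move=> [????] /=; congr Quat; ring. Qed.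

Lemma qconjM p q : qconj (qmul p q) = qmul (qconj q) (qconj p).
Proof. by case: p q => [????] [????] /=; rewrite /qconj /=; congr Quat; ring. Qed.

(** Real parts drop out of $pq - qp$, which is twice the cross product of the imaginary parts. *)
Lemma qcommP p q : qcomm p q <->
  [/\ qj p * qk q = qk p * qj q, qk p * qi q = qi p * qk q
    & qi p * qj q = qj p * qi q].
Proof.
case: p q => [a b c d] [a' b' c' d']; rewrite /qcomm /=; split=> [[] e1 e2 e3|[e1 e2 e3]].
  by split; lra.
by congr Quat; lra.
Qed.

Definition qreal (p : quat) : Prop := [/\ qi p = 0, qj p = 0 & qk p = 0].

Lemma qcomm_sym p q : qcomm p q -> qcomm q p.
Proof. by []. Qed.

(** Commuting means having parallel imaginary parts, and two vectors parallel to the same non-zero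
    vector are parallel. *)
Lemma qcomm_trans p q r : ~ qreal q -> qcomm p q -> qcomm q r -> qcomm p r.
Proof.
move=> nq /qcommP[e1 e2 e3] /qcommP[f1 f2 f3]; apply/qcommP.
case: p q r nq e1 e2 e3 f1 f2 f3 => [a b c d] [a' x y z] [a'' u v w] /= nq e1 e2 e3 f1 f2 f3.
have cz t : t * x = 0 -> t * y = 0 -> t * z = 0 -> t = 0.
  move=> h1 h2 h3; apply/eqP/negP => /negP t0; apply: nq; split => /=.
  - by move/eqP: h1; rewrite mulf_eq0 (negPf t0) => /eqP.
  - by move/eqP: h2; rewrite mulf_eq0 (negPf t0) => /eqP.
  - by move/eqP: h3; rewrite mulf_eq0 (negPf t0) => /eqP.
(* Multiplying the hypotheses by the coordinates of [p] and [r] beforehand leaves only linear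
   arithmetic for [lra]. *)
have M (t l r : rat) : l = r -> t * l = t * r by move->.
have := (M b _ _ f1, M c _ _ f1, M d _ _ f1, M b _ _ f2, M c _ _ f2, M d _ _ f2).
have := (M b _ _ f3, M c _ _ f3, M d _ _ f3, M u _ _ e1, M v _ _ e1, M w _ _ e1).
have := (M u _ _ e2, M v _ _ e2, M w _ _ e2, M u _ _ e3, M v _ _ e3, M w _ _ e3).
do 3 move=> [[[[[? ?] ?] ?] ?] ?].
by split; apply/eqP; rewrite -subr_eq0; apply/eqP; apply: cz; lra.
Qed.

(* Write [p = r + v] and [q = c + u] with [v], [u] imaginary and [w = u x v].
   The hypothesis reads [(u . v) w = c (w x v)], so [w != 0] would force
   [u . v = 0] and then [w x v = 0], which is absurd as [w] is orthogonal to
   [v]. *)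
Lemma qcomm_conj p q : qr q != 0 -> qcomm p (qmul (qconj q) (qmul p q)) -> qcomm p q.
Proof.
case: p q => [r v1 v2 v3] [c u1 u2 u3] /= c0 /qcommP/= [e1 e2 e3]; apply/qcommP => /=.
pose w1 := u2 * v3 - u3 * v2; pose w2 := u3 * v1 - u1 * v3; pose w3 := u1 * v2 - u2 * v1.
pose d := u1 * v1 + u2 * v2 + u3 * v3.
have h1 : d * w1 = c * (w2 * v3 - w3 * v2) by rewrite /d /w1 /w2 /w3; lra.
have h2 : d * w2 = c * (w3 * v1 - w1 * v3) by rewrite /d /w1 /w2 /w3; lra.
have h3 : d * w3 = c * (w1 * v2 - w2 * v1) by rewrite /d /w1 /w2 /w3; lra.
have dn : d * (w1 ^+ 2 + w2 ^+ 2 + w3 ^+ 2) = 0.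
  transitivity ((d * w1) * w1 + (d * w2) * w2 + (d * w3) * w3); first by ring.
  by rewrite h1 h2 h3; ring.
have sq3 (x y z : rat) : x ^+ 2 + y ^+ 2 + z ^+ 2 = 0 -> [/\ x = 0, y = 0 & z = 0].
  move=> h; have [[hx hy] hz] := (sqr_ge0 x, sqr_ge0 y, sqr_ge0 z).
  by split; apply/eqP; rewrite -sqrf_eq0; apply/eqP; lra.
suff [] : [/\ w1 = 0, w2 = 0 & w3 = 0] by rewrite /w1 /w2 /w3; split; lra.
move/eqP: dn; rewrite mulf_eq0 => /orP[/eqP d0|/eqP /sq3 //].
have cK x : 0 = c * x -> x = 0.
  by move/esym/eqP; rewrite mulf_eq0 (negPf c0) => /eqP.
rewrite d0 !mul0r in h1 h2 h3.
move/cK: h1 => h1; move/cK: h2 => h2; move/cK: h3 => h3.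
have : (w1 ^+ 2 + w2 ^+ 2 + w3 ^+ 2) * (v1 ^+ 2 + v2 ^+ 2 + v3 ^+ 2) = 0.
  transitivity ((w2 * v3 - w3 * v2) ^+ 2 + (w3 * v1 - w1 * v3) ^+ 2
    + (w1 * v2 - w2 * v1) ^+ 2); last by rewrite h1 h2 h3; ring.
  by rewrite /w1 /w2 /w3; ring.
move/eqP; rewrite mulf_eq0 => /orP[/eqP /sq3 //|/eqP /sq3 [z1 z2 z3]].
by rewrite /w1 /w2 /w3 z1 z2 z3; split; ring.
Qed.

(** * The two generators and the detection of non-trivial words *)

Definition qletter (x : letter) : quat :=
  let s : rat := if x.2 then -1 else 1 in
  if x.1 then Quat (3 / 5) 0 (s * (4 / 5)) 0 else Quat (3 / 5) (s * (4 / 5)) 0 0.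

Lemma qletterV x : qmul (qletter (inv_letter x)) (qletter x) = qone.
Proof. by case: x => [[] []]; rewrite /qletter /=; congr Quat; field. Qed.

Definition qeval := weval qmul qone qletter.

Lemma qeval_cat s t : qeval (s ++ t) = qmul (qeval s) (qeval t).
Proof. exact: (weval_cat _ qmulA qmul1). Qed.

Lemma qeval_winv s : qeval (winv s) = qconj (qeval s).
Proof.
elim: s => [|x s IH]; first by rewrite /qeval /qconj /= oppr0.
rewrite /winv /= rev_cons -cats1 qeval_cat IH qconjM; congr qmul.
by rewrite /qeval /= qmulx1; case: x => [[] []]; rewrite /qletter /qconj /=; congr Quat; ring.
Qed.

(* A 2-adic obstruction to being purely imaginary. *)
Definition qodd (p : quat) : Prop := exists (n : nat) (a b c d : int),
  [/\ 5 ^+ n * qr p = (2 * a + 1)%:~R, 5 ^+ n * qi p = (2 * b)%:~R,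
      5 ^+ n * qj p = (2 * c)%:~R & 5 ^+ n * qk p = (2 * d)%:~R].

Lemma qoddM p q : qodd p -> qodd q -> qodd (qmul p q).
Proof.
case: p q => [p0 p1 p2 p3] [q0 q1 q2 q3].
move=> [n [a [b [c [d [/= e0 e1 e2 e3]]]]]] [m [a' [b' [c' [d' [/= f0 f1 f2 f3]]]]]].
exists (n + m)%N,
  (2 * a * a' + a + a' - 2 * (b * b' + c * c' + d * d')),
  ((2 * a + 1) * b' + b * (2 * a' + 1) + 2 * (c * d' - d * c')),
  ((2 * a + 1) * c' + c * (2 * a' + 1) + 2 * (d * b' - b * d')),
  ((2 * a + 1) * d' + d * (2 * a' + 1) + 2 * (b * c' - c * b')) => /=.
have E (x y : rat) : 5 ^+ (n + m) * (x * y) = (5 ^+ n * x) * (5 ^+ m * y).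
  by rewrite exprD; ring.
by split; rewrite !(mulrBr, mulrDr) !E e0 e1 e2 e3 f0 f1 f2 f3 -!intrM -!(intrD, intrB);
  congr (_%:~R); ring.
Qed.

Lemma qodd_eval s : qodd (qeval s).
Proof.
elim: s => [|x s IH]; first by exists 0%N, 0, 0, 0, 0.
apply: qoddM IH.
exists 1%N, 1, (if x.1 then 0 else if x.2 then -2 else 2),
  (if x.1 then if x.2 then -2 else 2 else 0), 0.
by case: x => [[] []]; rewrite /qletter /=.
Qed.

Lemma qr_eval_neq0 s : qr (qeval s) != 0.
Proof.
have [n [a [b [c [d [e _ _ _]]]]]] := qodd_eval s.
apply/eqP => r0; move/esym/eqP: e; rewrite r0 mulr0 intr_eq0; lia.
Qed.

Lemma qcomm_winv s t : qcomm (qeval s) (qeval (winv t)) <-> qcomm (qeval s) (qeval t).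
Proof.
by rewrite qeval_winv; split=> /qcommP[e1 e2 e3]; apply/qcommP; split;
  move: e1 e2 e3; rewrite /qconj /=; lra.
Qed.

Lemma qcomm_wconj s t :
  qcomm (qeval s) (qeval (wconj t s)) -> qcomm (qeval s) (qeval t).
Proof.
by rewrite /wconj !qeval_cat qeval_winv; apply: qcomm_conj; apply: qr_eval_neq0.
Qed.

(** Cancelling [s] on the left of $s t^{-1} s^{-1} t$ shows that [s] commutes with the inverse of
    its conjugate [wconj t s], hence with that conjugate; [qcomm_wconj] concludes. *)
Lemma qcomm_wcomm s t :
  qcomm (qeval (wcomm s t)) (qeval s) -> qcomm (qeval s) (qeval t).
Proof.
move=> h; apply: qcomm_wconj; apply/qcomm_sym.
suff : qcomm (qeval (winv t ++ winv s ++ t)) (qeval s).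
  have <- : winv (wconj t s) = winv t ++ winv s ++ t.
    by rewrite /wconj !winv_cat winvK catA.
  by move/qcomm_sym/qcomm_winv.
move: h; rewrite /wcomm /qcomm [in qeval (s ++ _)]qeval_cat -qmulA.
set y := qeval (winv t ++ _) => h.
have K z : qmul (qeval (winv s)) (qmul (qeval s) z) = z.
  exact: (weval_Kl qmulA qmul1 qmulx1 qletterV).
by rewrite -[LHS]K h K.
Qed.

Lemma qcomm_real p q : qreal p -> qcomm p q.
Proof. by move=> [a b c]; apply/qcommP; rewrite a b c !mul0r. Qed.

(** One of $1, a, b$ works as [g]: otherwise, by transitivity through [s], [t] commutes with its
    conjugates by $a$ and $b$, hence with $a$ and $b$, and by transitivity through [t] these two
    would commute. *)
Lemma exists_wconj_noncomm s t : ~ qreal (qeval s) -> ~ qreal (qeval t) ->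
  exists g, ~ qcomm (qeval s) (qeval (wconj g t)).
Proof.
move=> ns nt.
have ext g : ~ qcomm (qeval s) (qeval (wconj g t)) \/ qcomm (qeval s) (qeval (wconj g t)).
  rewrite /qcomm; set p := qmul _ _; set q := qmul _ _.
  have [/= e|e] := eqVneq (qr p, qi p, qj p, qk p) (qr q, qi q, qj q, qk q).
    by right; case: p q e => [????] [????] /= [-> -> -> ->].
  by left => pq; rewrite pq eqxx in e.
have [|h0] := ext [::]; first by exists [::].
have [|h1] := ext [:: (false, false)]; first by exists [:: (false, false)].
have [|h2] := ext [:: (true, false)]; first by exists [:: (true, false)].
have st : qcomm (qeval t) (qeval s) by move: h0; rewrite /wconj /= cats0.
have /qcomm_wconj ta := qcomm_trans ns st h1.
have /qcomm_wconj tb := qcomm_trans ns st h2.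
have /qcommP := qcomm_trans nt (qcomm_sym ta) tb.
by rewrite {1 2 3 4 5 6}/qeval /weval /foldr !qmulx1 /= => -[_ _]; lra.
Qed.

(** Every positive power of $3 + 4i$ is congruent to $3 + 4i$ modulo 5, so its imaginary part is
    non-zero. *)
Lemma qreal_power n : ~ qreal (qeval (nseq n.+1 (false, false))).
Proof.
have [r [t [_ ht]]] : exists r t : int,
    5 ^+ n.+1 * qr (qeval (nseq n.+1 (false, false))) = (5 * r + 3)%:~R
    /\ 5 ^+ n.+1 * qi (qeval (nseq n.+1 (false, false))) = (5 * t + 4)%:~R.
  elim: n => [|n [r [t [hr ht]]]]; first by exists 0, 0.
  exists (3 * r - 4 * t - 2), (4 * r + 3 * t + 4).
  have -> : qeval (nseq n.+2 (false, false)) =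
    qmul (qletter (false, false)) (qeval (nseq n.+1 (false, false))) by [].
  case: (qeval _) hr ht => [p0 p1 p2 p3] /= hr ht.
  rewrite exprS /qletter /=; split.
    transitivity (3 * (5 ^+ n.+1 * p0) - 4 * (5 ^+ n.+1 * p1)); first by field.
    by rewrite hr ht; ring.
  transitivity (4 * (5 ^+ n.+1 * p0) + 3 * (5 ^+ n.+1 * p1)); first by field.
  by rewrite hr ht; ring.
by move=> [i0 _ _]; move/esym/eqP: ht; rewrite i0 mulr0 intr_eq0; lia.
Qed.

Lemma fib_word_noncomm s t n : ~ qcomm (qeval s) (qeval t) ->
  ~ qcomm (qeval (fib_word s t n.+1)) (qeval (fib_word s t n)).
Proof.
move=> nst; elim: n => [|n IH]; first by [].
rewrite {1}/qeval (weval_fib_word qmulA qmul1 qmulx1 qletterV) -/qeval.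
by move/qcomm_wcomm.
Qed.

Definition F2_of (s : seq letter) : F2 := exist _ (freduce s) (reduced_freduce s).

Lemma nontrivial_F2_of s : ~ qreal (qeval s) -> nontrivial (F2_of s).
Proof.
move=> ns; apply/eqP => /= s0; apply: ns.
by rewrite /qeval -(weval_freduce qmulA qmul1 qletterV) s0.
Qed.

(* Small as soon as one of [s], [t] is: quadratically in either of them. *)
Definition wmeet (s t : seq letter) : seq letter :=
  wcomm (wcomm s t) (wconj s (wcomm s t)).

(** A real value commutes with everything; peeling off the outer commutator, the conjugation by [s]
    and the inner commutator would then make [s] and [t] commute. *)
Lemma wmeet_nonreal s t : ~ qcomm (qeval s) (qeval t) -> ~ qreal (qeval (wmeet s t)).
Proof.
move=> nst /qcomm_real H; apply: nst; apply: qcomm_wcomm; apply: qcomm_wconj.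
exact: qcomm_wcomm (H _).
Qed.

(** * Operator bounds *)

Section OperatorBounds.
Variables (R : realType) (k : nat).
Implicit Types (v w : 'cV[R[i]]_k) (A B U : 'M[R[i]]_k) (r : R).

Definition vsq v : R := \sum_i (complex.Re (v i 0) ^+ 2 + complex.Im (v i 0) ^+ 2).

Lemma vsq_ge0 v : 0 <= vsq v.
Proof. by apply: sumr_ge0 => i _; apply: addr_ge0; apply: sqr_ge0. Qed.

Lemma vnorm_ge0 v : 0 <= vnorm v.
Proof. exact: sqrtr_ge0. Qed.

Lemma sqr_vnorm v : vnorm v ^+ 2 = vsq v.
Proof. by rewrite sqr_sqrtr // vsq_ge0. Qed.

Lemma le_vnorm v r : 0 <= r -> vsq v <= r ^+ 2 -> vnorm v <= r.
Proof. by move=> r0 h; rewrite -(ler_pXn2r (n := 2)) ?nnegrE ?vnorm_ge0 // sqr_vnorm. Qed.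

Lemma vsq_entry v i : complex.Re (v i 0) ^+ 2 + complex.Im (v i 0) ^+ 2 <= vsq v.
Proof.
rewrite /vsq (bigD1 i) //= lerDl; apply: sumr_ge0 => j _.
by apply: addr_ge0; apply: sqr_ge0.
Qed.

Lemma vnorm0_eq0 v : vnorm v = 0 -> v = 0.
Proof.
move=> v0; apply/matrixP => i j; rewrite ord1 mxE.
have := vsq_entry v i; rewrite -sqr_vnorm v0 expr0n /=.
have := sqr_ge0 (complex.Re (v i 0)); have := sqr_ge0 (complex.Im (v i 0)).
case: (v i 0) => a b /= hb ha h.
have /eqP : a ^+ 2 = 0 by lra.
have /eqP : b ^+ 2 = 0 by lra.
by rewrite !sqrf_eq0 => /eqP-> /eqP->.
Qed.

Lemma vnorm_triangle v w : vnorm (v + w) <= vnorm v + vnorm w.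
Proof.
have [/vnorm0_eq0->|v0] := eqVneq (vnorm v) 0; first by rewrite add0r lerDr vnorm_ge0.
have [/vnorm0_eq0->|w0] := eqVneq (vnorm w) 0; first by rewrite addr0 lerDl vnorm_ge0.
have {}v0 : 0 < vnorm v by rewrite lt_neqAle eq_sym v0 vnorm_ge0.
have {}w0 : 0 < vnorm w by rewrite lt_neqAle eq_sym w0 vnorm_ge0.
apply: le_vnorm; first by rewrite addr_ge0 ?vnorm_ge0.
set a := vnorm v in v0 *; set b := vnorm w in w0 *.
(* AM-GM: [a b |x + y|^2 <= (a + b) (b |x|^2 + a |y|^2)], summed over the entries. *)
suff h : a * b * vsq (v + w) <= a * b * (a + b) ^+ 2.
  by rewrite -(ler_pM2l (mulr_gt0 v0 w0)).
have -> : a * b * (a + b) ^+ 2 = (a + b) * (b * vsq v + a * vsq w).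
  by rewrite -!sqr_vnorm -/a -/b; ring.
rewrite /vsq !mulr_sumr -big_split /= mulr_sumr; apply: ler_sum => i _.
rewrite mxE; case: (v i 0) (w i 0) => [x1 x2] [y1 y2] /=.
have := sqr_ge0 (b * x1 - a * y1); have := sqr_ge0 (b * x2 - a * y2); nra.
Qed.

Lemma vnormN v : vnorm (- v) = vnorm v.
Proof.
by rewrite /vnorm; congr Num.sqrt; apply: eq_bigr => i _; rewrite mxE;
  case: (v i 0) => a b /=; rewrite !sqrrN.
Qed.

Lemma vsqC v : ((vsq v)%:C)%C = ((map_mx Num.conj v)^T *m v) 0 0 :> R[i].
Proof.
rewrite mxE rmorph_sum /=; apply: eq_bigr => i _; rewrite !mxE.
by rewrite add_Re2_Im2 normCK mulrC.
Qed.

(** Since the identity is central, subtracting it from both factors preserves the commutator; this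
    makes commutator estimates quadratic. *)
Lemma mx_commB1 A B :
  (A - 1%:M) *m (B - 1%:M) - (B - 1%:M) *m (A - 1%:M) = A *m B - B *m A.
Proof.
have K (x y z : 'M[R[i]]_k) : x - z - (y - z) = x - y by rewrite opprB addrA subrK.
rewrite [_ *m (B - _)]mulmxBr mulmx1 [(B - _) *m _]mulmxBl mul1mx K.
by rewrite mulmxBl mulmxBr mul1mx mulmx1 K.
Qed.

Definition unitary U : Prop := adjmx U *m U = 1%:M.

Lemma vnorm_unitary U v : unitary U -> vnorm (U *m v) = vnorm v.
Proof.
move=> hU; suff h : vsq (U *m v) = vsq v by rewrite /vnorm -/(vsq (U *m v)) h.
suff : ((vsq (U *m v))%:C)%C = ((vsq v)%:C)%C :> R[i] by move=> [].
by rewrite !vsqC map_mxM trmx_mul mulmxA -(mulmxA _ _ U) [_^T *m U]hU mulmx1.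
Qed.

(** The operator norm bound in homogeneous form, which keeps the supremum out of the estimates until
    [opnorm_le]. *)
Definition bounded_by A r : Prop := forall v, vnorm (A *m v) <= r * vnorm v.

Lemma bounded_byW A r r' : r <= r' -> bounded_by A r -> bounded_by A r'.
Proof. by move=> h hA v; apply: le_trans (hA v) _; rewrite ler_wpM2r ?vnorm_ge0. Qed.

Lemma bounded_byM A B r r' : 0 <= r ->
  bounded_by A r -> bounded_by B r' -> bounded_by (A *m B) (r * r').
Proof.
move=> r0 hA hB v; rewrite -mulmxA; apply: le_trans (hA _) _.
by rewrite -mulrA ler_wpM2l.
Qed.

Lemma bounded_byD A B r r' :
  bounded_by A r -> bounded_by B r' -> bounded_by (A + B) (r + r').
Proof.
move=> hA hB v; rewrite mulmxDl mulrDl; apply: le_trans (vnorm_triangle _ _) _.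
exact: lerD.
Qed.

Lemma bounded_byN A r : bounded_by A r -> bounded_by (- A) r.
Proof. by move=> hA v; rewrite mulNmx vnormN. Qed.

Lemma bounded_byB A B r r' :
  bounded_by A r -> bounded_by B r' -> bounded_by (A - B) (r + r').
Proof. by move=> hA /bounded_byN; apply: bounded_byD. Qed.

Lemma unitary_bounded_by U : unitary U -> bounded_by U 1.
Proof. by move=> hU v; rewrite vnorm_unitary // mul1r. Qed.

Lemma adjmxM A B : adjmx (A *m B) = adjmx B *m adjmx A.
Proof. by rewrite /adjmx map_mxM trmx_mul. Qed.

Lemma adjmxK A : adjmx (adjmx A) = A.
Proof. by apply/matrixP => i j; rewrite !mxE conjCK. Qed.

Lemma unitary1 : unitary 1%:M.
Proof. by rewrite /unitary /adjmx map_mx1 trmx1 mulmx1. Qed.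

Lemma unitaryM A B : unitary A -> unitary B -> unitary (A *m B).
Proof.
move=> hA hB; rewrite /unitary adjmxM mulmxA -(mulmxA _ _ A).
by rewrite [_ *m A]hA mulmx1.
Qed.

Lemma unitaryV U : unitary U -> unitary (invmx U).
Proof.
move=> hU; have [_ uU] := mulmx1_unit hU.
have -> : invmx U = adjmx U by rewrite -[RHS]mulmx1 -(mulmxV uU) mulmxA hU mul1mx.
by rewrite /unitary adjmxK; apply: mulmx1C.
Qed.

Lemma vnorm0 : vnorm (0 : 'cV[R[i]]_k) = 0.
Proof.
apply/eqP; rewrite eq_le vnorm_ge0 andbT; apply: le_vnorm => //.
by rewrite /vsq big1 ?expr0n // => i _; rewrite mxE /= expr0n addr0.
Qed.

Lemma opnorm_le A r : 0 <= r -> bounded_by A r -> opnorm A <= r.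
Proof.
move=> r0 hA; apply: ge_sup.
  by exists 0, 0; rewrite mulmx0 vnorm0.
by move=> _ [v [v1 ->]]; apply: le_trans (hA v) _; rewrite ler_piMr.
Qed.

(** * Matrix entries and powers of a unitary matrix *)

Lemma bounded_by_delta i j : bounded_by (delta_mx i j) 1.
Proof.
move=> v; rewrite mul1r; apply: le_vnorm; first exact: vnorm_ge0.
rewrite sqr_vnorm; apply: le_trans (vsq_entry v j).
rewrite /vsq (bigD1 i) //= big1 ?addr0 => [|i' ii'].
  rewrite mxE (bigD1 j) //= big1 => [|j' jj']; first by rewrite !mxE !eqxx mul1r addr0.
  by rewrite !mxE (negPf jj') andbF mul0r.
rewrite mxE big1 => [|j' _]; first by rewrite /= expr0n addr0.
by rewrite !mxE (negPf ii') mul0r.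
Qed.

Lemma bounded_byZ (z : R[i]) A r r' : 0 <= r' ->
  complex.Re z ^+ 2 + complex.Im z ^+ 2 <= r' ^+ 2 ->
  bounded_by A r -> bounded_by (z *: A) (r' * r).
Proof.
move=> r0 hz hA v; rewrite -scalemxAl -mulrA.
apply: le_trans (ler_wpM2l r0 (hA v)).
apply: le_vnorm; first by rewrite mulr_ge0 ?vnorm_ge0.
rewrite exprMn sqr_vnorm; apply: le_trans (ler_wpM2r (vsq_ge0 _) hz).
rewrite /vsq mulr_sumr; apply: ler_sum => i _; rewrite mxE.
by case: z ((A *m v) i 0) {hz} => [a b] [c d] /=; lra.
Qed.

Lemma bounded_by_sum (I : finType) (F : I -> 'M[R[i]]_k) r :
  (forall i, bounded_by (F i) r) -> bounded_by (\sum_i F i) (#|I|%:R * r).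
Proof.
move=> hF; have -> : #|I|%:R * r = \sum_(i : I) r by rewrite sumr_const mulr_natl.
elim/big_ind2: _ => [|A1 r1 A2 r2|i _]; last exact: hF.
  by move=> v; rewrite mul0mx vnorm0 mul0r.
exact: bounded_byD.
Qed.

(** Expansion in the $k^2$ matrix units; the modulus of each entry is at most $\sqrt{2} r$, rounded
    up to $2r$. *)
Lemma bounded_by_entries A r : 0 <= r ->
  (forall i j, `|complex.Re (A i j)| <= r /\ `|complex.Im (A i j)| <= r) ->
  bounded_by A (k%:R * (k%:R * (2 * r))).
Proof.
move=> r0 hA; rewrite [A]matrix_sum_delta -[X in X%:R * _]card_ord.
apply: bounded_by_sum => i; rewrite -[X in X%:R * _]card_ord.
apply: bounded_by_sum => j; rewrite -[2 * r]mulr1.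
apply: bounded_byZ (bounded_by_delta i j); first by lra.
have [h1 h2] := hA i j; rewrite -real_normK ?num_real // -[X in _ + X]real_normK ?num_real //.
have := normr_ge0 (complex.Re (A i j)); have := normr_ge0 (complex.Im (A i j)); nra.
Qed.

Lemma unitary_entry U i j : unitary U ->
  `|complex.Re (U i j)| <= 1 /\ `|complex.Im (U i j)| <= 1.
Proof.
move=> hU; pose e : 'cV[R[i]]_k := delta_mx j 0.
have e1 : vsq e <= 1.
  rewrite /vsq (bigD1 j) //= big1 => [|l lj]; first by rewrite !mxE !eqxx /=; lra.
  by rewrite !mxE (negPf lj) /=; lra.
have := vsq_entry (U *m e) i.
rewrite -sqr_vnorm vnorm_unitary // sqr_vnorm => /le_trans/(_ e1).
have -> : (U *m e) i 0 = U i j.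
  rewrite mxE (bigD1 j) //= big1 => [|l lj]; first by rewrite !mxE !eqxx mulr1 addr0.
  by rewrite !mxE (negPf lj) mulr0.
have := sqr_ge0 (complex.Re (U i j)); have := sqr_ge0 (complex.Im (U i j)) => h1 h2 h3.
by split; rewrite -(ler_pXn2r (n := 2)) ?nnegrE // real_normK ?num_real // expr1n; lra.
Qed.

Lemma unitaryX U n : unitary U -> unitary (U ^+ n).
Proof.
by move=> hU; elim: n => [|n IH]; [exact: unitary1|rewrite exprS; apply: unitaryM].
Qed.

(* Pigeonhole on a grid of mesh [1/N] in the space of matrix entries: two of the
   powers [U^0, ..., U^M] fall in the same cell. *)
Lemma unitary_power_near1 r : 0 < r -> exists M : nat, forall U, unitary U ->
  exists2 n, (n < M)%N & bounded_by (U ^+ n.+1 - 1%:M) r.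
Proof.
move=> r0.
(* The mesh is fine enough for [bounded_by_entries], at entry size $1/N$, to give at most [r]. *)
pose N := (Num.truncn (k%:R * (k%:R * 2) / r)).+1.
have N0 : 0 < N%:R :> R by rewrite ltr0n.
have hN : k%:R * (k%:R * (2 * N%:R^-1)) <= r.
  have : k%:R * (k%:R * 2) / r < N%:R :> R by exact: truncnS_gt.
  by rewrite ltr_pdivrMr // !mulrA ler_pdivrMr // [r * _]mulrC => /ltW.
(* Entries of unitary matrices have real and imaginary parts in $[-1, 1]$, which is mapped onto
   $[0, 2N]$; the endpoint accounts for the extra cell. *)
pose cell (x : R) : 'I_(2 * N).+1 := inord (Num.truncn ((x + 1) * N%:R)).
have cellE (x y : R) : `|x| <= 1 -> `|y| <= 1 -> cell x = cell y -> `|x - y| <= N%:R^-1.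
  move=> hx hy /(congr1 val) /=.
  have bd (z : R) : `|z| <= 1 -> 0 <= (z + 1) * N%:R /\ (Num.truncn ((z + 1) * N%:R) < (2 * N).+1)%N.
    rewrite ler_norml => /andP[z1 z2].
    have z0 : 0 <= (z + 1) * N%:R by rewrite mulr_ge0 //; lra.
    split => //; rewrite ltnS truncn_le_nat; apply: (@le_lt_trans _ _ (2 * N)%:R).
      by rewrite natrM ler_pM2r //; lra.
    by rewrite ltr_nat.
  have [[x0 tx] [y0 ty]] := (bd _ hx, bd _ hy).
  rewrite !inordK // => e.
  have /andP[] := truncn_itv x0; have /andP[] := truncn_itv y0; rewrite e.
  set t := Num.truncn _ => a1 a2 a3 a4.
  rewrite -(ler_pM2r N0) mulVf ?gt_eqF // -[X in _ * X]gtr0_norm // -normrM mulrBl.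
  rewrite ler_norml; move: a1 a2 a3 a4; rewrite -!natr1 !mulrDl !mul1r => *.
  by apply/andP; split; lra.
pose grid U := ([ffun p : 'I_k * 'I_k => (cell (complex.Re (U p.1 p.2)), cell (complex.Im (U p.1 p.2)))]).
pose M := #|{ffun 'I_k * 'I_k -> 'I_(2 * N).+1 * 'I_(2 * N).+1}|.
exists M => U hU.
have /injectivePn[x [y xy gxy]] : ~~ injectiveb (fun n : 'I_M.+1 => grid (U ^+ n)).
  by apply/negP => /injectiveP /leq_card; rewrite card_ord ltnn.
wlog lxy : x y xy gxy / (x < y)%N.
  move=> H; have [/H|/H|/val_inj e] := ltngtP x y; [exact | | by rewrite e eqxx in xy].
  by apply; rewrite 1?eq_sym.
exists (y - x).-1; first by have := ltn_ord y; lia.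
rewrite prednK ?subn_gt0 //.
(* Factoring out the unitary $U^{-x}$ turns closeness of two powers into closeness of $U^{y-x}$ to
   1. *)
have -> : U ^+ (y - x) - 1%:M = invmx (U ^+ x) *m (U ^+ y - U ^+ x).
  have uX : U ^+ x \in unitmx by case: (mulmx1_unit (unitaryX x hU)).
  by rewrite mulmxBr mulVmx // -{2}(subnKC (ltnW lxy)) exprD mulKmx.
rewrite -[r]mul1r; apply: bounded_byM => //.
  exact/unitary_bounded_by/unitaryV/unitaryX.
apply: bounded_byW hN _; apply: bounded_by_entries; first by rewrite invr_ge0 ltW.
move=> i j; have := congr1 (fun f : {ffun _ -> _} => f (i, j)) gxy; rewrite !ffunE /= => -[cR cI].
have [a1 a2] := unitary_entry i j (unitaryX x hU).
have [b1 b2] := unitary_entry i j (unitaryX y hU).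
have -> : (U ^+ y - U ^+ x) i j = (U ^+ y) i j - (U ^+ x) i j by rewrite !mxE.
move: cR cI a1 a2 b1 b2; case: ((U ^+ x) i j) ((U ^+ y) i j) => [p q] [p' q'] /= *.
by split; apply: cellE.
Qed.

(** * Distance to 1 of words in two unitary matrices *)

Section WordBounds.
Variables u v : 'M[R[i]]_k.
Hypotheses (hu : unitary u) (hv : unitary v).

Definition mxeval := weval mulmx 1%:M (eval_letter u v).

Lemma unitary_eval_letter x : unitary (eval_letter u v x).
Proof. by case: x => [[] []]; rewrite /eval_letter /=; try apply: unitaryV. Qed.

Lemma eval_letterV x :
  eval_letter u v (inv_letter x) *m eval_letter u v x = 1%:M.
Proof.
have uP U : unitary U -> U \in unitmx by move=> hU; case: (mulmx1_unit hU).
by case: x => [[] []]; rewrite /eval_letter /= ?(mulVmx, mulmxV) //; apply: uP.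
Qed.

Lemma unitary_mxeval s : unitary (mxeval s).
Proof.
elim: s => [|x s IH]; first exact: unitary1.
exact: unitaryM (unitary_eval_letter x) IH.
Qed.

Lemma mxeval_cat s t : mxeval (s ++ t) = mxeval s *m mxeval t.
Proof. exact: (weval_cat _ (@mulmxA _ _ _ _ _) (@mul1mx _ _ _)). Qed.

Lemma mxeval_winvl s : mxeval (winv s) *m mxeval s = 1%:M.
Proof. exact: (weval_winvl (@mulmxA _ _ _ _ _) (@mul1mx _ _ _) (@mulmx1 _ _ _) eval_letterV). Qed.

Lemma mxeval_winvr s : mxeval s *m mxeval (winv s) = 1%:M.
Proof. exact: mulmx1C (mxeval_winvl s). Qed.

Definition near1 s r : Prop := bounded_by (mxeval s - 1%:M) r.

Lemma near1_2 s : near1 s 2.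
Proof. exact: bounded_byB (unitary_bounded_by (unitary_mxeval s)) (unitary_bounded_by unitary1). Qed.

Lemma near1_winv s r : near1 s r -> near1 (winv s) r.
Proof.
move=> h; rewrite /near1.
have -> : mxeval (winv s) - 1%:M = mxeval (winv s) *m (- (mxeval s - 1%:M)).
  by rewrite opprB mulmxBr mulmx1 mxeval_winvl.
rewrite -[r]mul1r; apply: bounded_byM => //; last exact: bounded_byN.
exact/unitary_bounded_by/unitary_mxeval.
Qed.

Lemma near1_wconj t s r : near1 s r -> near1 (wconj t s) r.
Proof.
move=> h; rewrite /near1.
have -> : mxeval (wconj t s) - 1%:M = mxeval (winv t) *m ((mxeval s - 1%:M) *m mxeval t).
  by rewrite /wconj !mxeval_cat mulmxBl mulmxBr mul1mx mxeval_winvl.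
move=> w; rewrite -!mulmxA vnorm_unitary; last exact: unitary_mxeval.
by apply: le_trans (h _) _; rewrite vnorm_unitary //; exact: unitary_mxeval.
Qed.

(** With $a$, $b$ the values of [s] and [winv t], one has $aba^{-1}b^{-1} - 1 = ((a-1)(b-1) -
    (b-1)(a-1)) a^{-1}b^{-1}$, whose last factor is unitary. *)
Lemma near1_wcomm s t r r' : 0 <= r -> 0 <= r' ->
  near1 s r -> near1 t r' -> near1 (wcomm s t) (2 * (r * r')).
Proof.
move=> r0 r'0 hs /near1_winv ht; rewrite /near1.
have -> : mxeval (wcomm s t) - 1%:M =
   ((mxeval s - 1%:M) *m (mxeval (winv t) - 1%:M)
    - (mxeval (winv t) - 1%:M) *m (mxeval s - 1%:M)) *m mxeval (winv s ++ t).
  rewrite mx_commB1.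
  rewrite mulmxBl !mxeval_cat -!mulmxA [mxeval s *m (mxeval (winv s) *m _)]mulmxA.
  by rewrite mxeval_winvr mul1mx mxeval_winvl.
rewrite -[2 * _]mulr1; apply: bounded_byM; first by rewrite !mulr_ge0.
  have -> : 2 * (r * r') = r * r' + r' * r by ring.
  by apply: bounded_byB; apply: bounded_byM.
exact/unitary_bounded_by/unitary_mxeval.
Qed.

End WordBounds.
End OperatorBounds.

(** * Seed words and growth *)

Section SeedWords.
Variables (R : realType) (k : nat).
Implicit Types u v : 'M[R[i]]_k.

(** The trivial bound 2 on the other word puts the inner commutator and its conjugate within $4r$ of
    1; then $2 (4r)^2 = 32 r^2$. *)
Lemma near1_wmeet u v s t (r : R) : unitary u -> unitary v -> 0 <= r ->
  near1 u v s r \/ near1 u v t r -> near1 u v (wmeet s t) (32 * r ^+ 2).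
Proof.
move=> hu hv r0 st.
have c4 : near1 u v (wcomm s t) (4 * r).
  case: st => h.
    have -> : 4 * r = 2 * (r * 2) by ring.
    by apply: near1_wcomm => //; apply: near1_2.
  have -> : 4 * r = 2 * (2 * r) by ring.
  by apply: near1_wcomm => //; apply: near1_2.
have -> : 32 * r ^+ 2 = 2 * ((4 * r) * (4 * r)) by ring.
have r4 : 0 <= 4 * r by lra.
by apply: near1_wcomm => //; apply: near1_wconj.
Qed.

Lemma mxeval_power u v n : mxeval u v (nseq n (false, false)) = u ^+ n.
Proof. by elim: n => [|n IH] //; rewrite exprS -IH. Qed.

Lemma exists_meet_powers (M : nat) : exists2 s, ~ qreal (qeval s) &
  forall u v, unitary u -> unitary v ->
  (exists2 n, (n <= M)%N & near1 u v (nseq n.+1 (false, false)) (1 / 64)) ->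
  near1 u v s (1 / 64).
Proof.
elim: M => [|M [s ns IH]].
  exists [:: (false, false)]; first exact: (@qreal_power 0).
  by move=> u v hu hv [n]; rewrite leqn0 => /eqP->.
have [g hg] := exists_wconj_noncomm ns (@qreal_power M.+1).
(* Level [M] covers the exponents 1 to $M + 1$, so the next power to merge is $a^{M+2}$. *)
exists (wmeet s (wconj g (nseq M.+2 (false, false)))); first exact: wmeet_nonreal.
move=> u v hu hv [n nM hn].
have c0 : 0 <= 1 / 64 :> R by lra.
(* As $32 / 64^2 = 1/128$, the radius $1/64$ survives each merging. *)
apply: (@bounded_byW _ _ _ (32 * (1 / 64) ^+ 2)); first by lra.
apply: near1_wmeet => //; move: nM; rewrite leq_eqVlt => /orP[/eqP nM|nM].
  by right; apply: near1_wconj => //; rewrite -nM.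
by left; apply: IH => //; exists n.
Qed.

(** The second seed is a non-commuting conjugate of the first, hence equally close to 1. *)
Lemma exists_seed_words : exists s t, ~ qcomm (qeval s) (qeval t) /\
  forall u v, unitary u -> unitary v -> near1 u v s (1 / 64) /\ near1 u v t (1 / 64).
Proof.
have c0 : 0 < 1 / 64 :> R by lra.
have [M hM] := unitary_power_near1 k c0.
have [s ns hs] := exists_meet_powers M.
have [g hg] := exists_wconj_noncomm ns ns.
exists s, (wconj g s); split=> // u v hu hv.
suff h : near1 u v s (1 / 64) by split=> //; apply: near1_wconj.
have [n nM hn] := hM u hu.
by apply: hs => //; exists n; [exact: ltnW | rewrite /near1 mxeval_power].
Qed.

Lemma word_map_F2_of s u v : unitary u -> unitary v ->
  word_map (F2_of s) u v = mxeval u v s.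
Proof.
move=> hu hv.
exact: (weval_freduce (@mulmxA _ _ _ _ _) (@mul1mx _ _ _) (eval_letterV hu hv)).
Qed.

Lemma near1_dist u v s (r : R) : unitary u -> unitary v -> 0 <= r ->
  near1 u v s r -> dist 1%:M (word_map (F2_of s) u v) <= r.
Proof.
move=> hu hv r0 h; rewrite word_map_F2_of //; apply: opnorm_le => //.
by rewrite -opprB; apply: bounded_byN.
Qed.

End SeedWords.

(** * The golden ratio and the exponent $\log_2 \varphi$ *)

Section GoldenRatio.
Variable R : realType.
Local Notation phi := (golden_ratio R).

Lemma golden_ratio_bounds : 3 / 2 <= phi <= 2.
Proof.
have s5 : Num.sqrt 5 ^+ 2 = 5 :> R by rewrite sqr_sqrtr.
have s0 : 0 <= Num.sqrt 5 :> R := sqrtr_ge0 _.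
rewrite /golden_ratio; set s := Num.sqrt 5 in s5 s0 *.
have s2 : 2 <= s by nra.
have s3 : s <= 3 by nra.
by apply/andP; split; lra.
Qed.

Lemma golden_ratio_expSS n : phi ^+ n.+2 = phi ^+ n.+1 + phi ^+ n.
Proof.
have s5 : Num.sqrt 5 ^+ 2 = 5 :> R by rewrite sqr_sqrtr.
suff h : phi ^+ 2 = phi + 1 by rewrite -addn2 exprD h exprS; ring.
by rewrite /golden_ratio; set s := Num.sqrt 5 in s5 *; lra.
Qed.

(** Linear growth is enough to make the final bounds tend to 0. *)
Lemma golden_ratio_exp_ge n : n%:R / 2 <= phi ^+ n.
Proof.
have /andP[p1 _] := golden_ratio_bounds.
suff [] : n%:R / 2 <= phi ^+ n /\ 1 <= phi ^+ n by [].
elim: n => [|n [h1 h2]]; first by rewrite expr0; lra.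
by rewrite exprS -natr1; nra.
Qed.

(** Converts the length scale $2^n$ into the decay exponent $\varphi^n$. *)
Lemma powR_exp2_golden_ratio n :
  (2 ^+ n) `^ (ln phi / ln 2) = phi ^+ n :> R.
Proof.
have /andP[p1 _] := golden_ratio_bounds.
have l2 : 0 < ln 2 :> R by rewrite ln_gt0 //; lra.
have h2 : 2 `^ (ln phi / ln 2) = phi.
  by rewrite /powR pnatr_eq0 /= divfK ?gt_eqF // lnK // posrE; lra.
rewrite -powR_mulrn; last by lra.
by rewrite -powRrM mulrC powRrM h2 powR_mulrn //; lra.
Qed.

End GoldenRatio.

(** * Decay of the Fibonacci words against their length *)

Theorem theorem3p1 (R : realType) (k : nat) :
  exists (w : nat -> F2) (C : R),
    0 < C /\ almost_law R k w /\
    forall n : nat,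
      Lk R k (w n) <=
      expR (- (C * ((wlen (w n))%:R `^ (ln (golden_ratio R) / ln 2)))).
Proof.
have [s [t [nst near_st]]] := exists_seed_words R k.
set phi := golden_ratio R; set al := ln phi / ln 2.
have /andP[p1 p2] : 3 / 2 <= phi <= 2 := golden_ratio_bounds R.
have l2 : 0 < ln 2 :> R by rewrite ln_gt0 //; lra.
(* As $\varphi^0, \varphi^1 \le 2$, this gives $e_0, e_1 \ge 1/2$, so the seeds satisfy the bound
   $e_n / 2$. *)
pose c : R := ln 2 / 2.
have c0 : 0 < c by rewrite /c; lra.
pose e n : R := expR (- (c * phi ^+ n)).
have e0 n : 0 < e n by exact: expR_gt0.
have near n (u v : 'M[R[i]]_k) : unitary u -> unitary v -> near1 u v (fib_word s t n) (e n / 2).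
  move=> hu hv; have [hs ht] := near_st u v hu hv.
  have ebig m : phi ^+ m <= 2 -> 1 / 64 <= e m / 2.
    move=> pm; suff : expR (- ln 2) <= e m by rewrite expRN lnK ?posrE //; lra.
    by rewrite ler_expR lerN2 /c; nra.
  suff [] : near1 u v (fib_word s t n) (e n / 2) /\
            near1 u v (fib_word s t n.+1) (e n.+1 / 2) by [].
  elim: n => [|n [IH1 IH2]].
    by split; [apply: bounded_byW ht|apply: bounded_byW hs]; apply: ebig;
      rewrite ?expr0 ?expr1 //; lra.
  split=> //; rewrite /near1 /mxeval.
  rewrite (weval_fib_word (@mulmxA _ _ _ _ _) (@mul1mx _ _ _) (@mulmx1 _ _ _)
    (eval_letterV hu hv)).
  (* The halved bounds absorb the factor 2 of the commutator estimate exactly. *)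
  have -> : e n.+2 / 2 = 2 * (e n.+1 / 2 * (e n / 2)).
    by rewrite /e golden_ratio_expSS mulrDr opprD expRD; field.
  by apply: near1_wcomm => //; rewrite divr_ge0 // ltW.
have dist_le n (u v : 'M[R[i]]_k) : SU u -> SU v ->
    dist 1%:M (word_map (F2_of (fib_word s t n)) u v) <= e n / 2.
  by move=> [hu _] [hv _]; apply: near1_dist => //; [rewrite divr_ge0 // ltW|exact: near].
(* All lengths are at most $D 2^n$; the successor makes [D] positive outright. *)
pose D := (2 * maxn (size s) (size t)).+1.
have D0 : 0 < D%:R `^ al :> R by rewrite powR_gt0 // ltr0n.
have al0 : 0 <= al by rewrite divr_ge0 ?ln_ge0 //; lra.
(* From $\ell \le D 2^n$ follows $\ell^{\log_2 \varphi} \le D^{\log_2 \varphi} \varphi^n$, which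
   dictates the constant. *)
exists (fun n => F2_of (fib_word s t n)), (c / D%:R `^ al).
split; [exact: divr_gt0|split; [split|]].
- move=> n; apply: nontrivial_F2_of => h.
  by apply: (fib_word_noncomm nst (n := n)); apply/qcomm_sym/qcomm_real.
(* Beyond this rank $c \varphi^n \varepsilon \ge 1$, while $e^x \ge 1 + x$ gives $e_n \cdot c
   \varphi^n \le 1$; hence $e_n \le \varepsilon$. *)
- move=> eps eps0; exists (Num.truncn (2 / (c * eps))).+1 => n hn u v hu hv.
  apply: le_lt_trans (dist_le n u v hu hv) _.
  have hn' : 2 / (c * eps) < n%:R.
    by apply: lt_le_trans (truncnS_gt _) _; rewrite ler_nat.
  rewrite ltr_pdivrMr ?mulr_gt0 // in hn'.
  have h1 := golden_ratio_exp_ge R n.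
  have h2 : 1 + c * phi ^+ n <= expR (c * phi ^+ n) := expR_ge1Dx _.
  have h3 : e n * expR (c * phi ^+ n) = 1 by rewrite /e -expRD addNr expR0.
  have en := e0 n.
  have h4 : e n * (c * phi ^+ n) <= 1.
    by rewrite -h3 ler_pM2l //; apply: le_trans h2; rewrite lerDr.
  have h5 : n%:R / 2 * (c * eps) <= phi ^+ n * (c * eps).
    by rewrite ler_wpM2r // mulr_ge0 // ltW.
  have h6 : 1 <= c * phi ^+ n * eps by lra.
  have h7 : e n * (c * phi ^+ n) * eps <= eps by rewrite ler_piMl // ltW.
  have h8 : e n <= e n * (c * phi ^+ n * eps) by rewrite ler_peMr // ltW.
  by lra.
- move=> n; apply: (@le_trans _ _ (e n)).
    apply: ge_sup.
      have S1 : SU (1%:M : 'M[R[i]]_k) by split; [exact: unitary1|exact: det1].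
      by eexists; exists 1%:M, 1%:M.
    by move=> _ [u [v [hu [hv ->]]]]; apply: le_trans (dist_le n u v hu hv) _; have := e0 n; lra.
  rewrite ler_expR lerN2 mulrAC ler_pdivrMr // -[c * phi ^+ n * _]mulrA ler_pM2l //.
  rewrite mulrC -(powR_exp2_golden_ratio R n) -powRM ?ler0n ?exprn_ge0 //.
  apply: ge0_ler_powR => //; rewrite ?nnegrE ?mulr_ge0 ?exprn_ge0 ?ler0n //.
  rewrite -natrX -natrM ler_nat; apply: leq_trans (size_freduce _) _.
  by apply: leq_trans (size_fib_word s t n) _; rewrite leq_mul2r leqnSn orbT.
Qed.
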